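(* For $2\le j\le n$ the matrix functions $H_j$, defined by writing the Knizhnik–Zamolodchikov system in the variables $u=(u_1,\dots,u_n)$ as $$\frac{\partial W}{\partial u_j}=\rho H_j(u)W,\qquad 1\le j\le n,$$ do not depend on $u_1$.
   Context: The Knizhnik–Zamolodchikov system is $\frac{\partial W}{\partial z_j}=\rho A_jW$, $1\le j\le n$, with $A_j=\sum_{k\ne j}\frac{P_{j,k}}{z_j-z_k}$ and $z_k\ne z_\ell$ for $k\neq\ell$; $\rho$ is arbitrary (not necessarily an integer). For $i\ne j$, $P_{i,j}=P_{j,i}$ is the $n\times n$ permutation matrix of the transposition $(i;j)$: its $(i,j)$ and $(j,i)$ entries are $1$, its $(k,k)$ entries are $1$ for $k\ne i,j$, and all other entries are $0$. The new variables are $$u_1=z_1-z_2,\quad u_k=\frac{z_k-z_{k+1}}{z_{k-1}-z_k}\ (2\le k\le n-1),\quad u_n=z_1+z_2+\dots+z_n,$$ and by the chain rule $H_j(u)=\sum_{k=1}^n\frac{\partial z_k}{\partial u_j}A_k$, expressed in the variables $u$. *)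

(* Defs.v *)
From HB Require Import structures.
From mathcomp Require Import all_boot all_order all_algebra all_fingroup.
From mathcomp Require Import all_classical all_reals all_analysis.

Set Implicit Arguments.
Unset Strict Implicit.
Unset Printing Implicit Defensive.

Import Order.TTheory GRing.Theory Num.Theory.
Import numFieldNormedType.Exports.

Local Open Scope classical_set_scope.
Local Open Scope ring_scope.

(* Indices run over 'I_n = {0, ..., n-1}: the coordinate z_k (resp. u_k) of the
   mathematical text is [z 0 i] (resp. [u 0 i]) with i = k - 1.  The scalars K
   are an arbitrary numFieldType, which covers the complex and the real numbers;
   derivatives are those of functions of n variables in K. *)

Definition kz_config (K : numFieldType) (n : nat) : set 'rV[K]_n :=
  [set z | forall k l : 'I_n, k != l -> z 0 k != z 0 l].

Definition kz_A (K : numFieldType) (n : nat) (j : 'I_n) (z : 'rV[K]_n) :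
    'M[K]_n :=
  \sum_(k < n | k != j) (z 0 j - z 0 k)^-1 *: tperm_mx j k.

(* [ordS] and [ord_pred] are the cyclic successor and predecessor of 'I_n; the
   tests on i ensure that they are never used across the boundary.  The indices
   of u_1 and u_n differ only for 1 < n. *)
Definition kz_u_of_z (K : numFieldType) (n : nat) (z : 'rV[K]_n) : 'rV[K]_n :=
  \row_(i < n)
    if i.+1 == n then \sum_(k < n) z 0 k
    else if i == 0%N :> nat then z 0 i - z 0 (ordS i)
    else (z 0 i - z 0 (ordS i)) / (z 0 (ord_pred i) - z 0 i).

Definition kz_udom (K : numFieldType) (n : nat) : set 'rV[K]_n :=
  @kz_u_of_z K n @` @kz_config K n.

(* The old variables as functions of the new ones: the inverse of [kz_u_of_z],
   which is injective on [kz_config] (junk values outside [kz_udom]). *)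
Definition kz_z_of_u (K : numFieldType) (n : nat) : 'rV[K]_n -> 'rV[K]_n :=
  'pinv_(fun=> 0) (@kz_config K n) (@kz_u_of_z K n).

Definition partial_derivative (K : numFieldType) (n : nat)
    (V : normedModType K) (j : 'I_n) (f : 'rV[K]_n -> V) (x : 'rV[K]_n) : V :=
  'D_(delta_mx 0 j) f x.

Definition kz_H (K : numFieldType) (n : nat) (j : 'I_n) (u : 'rV[K]_n) :
    'M[K]_n :=
  \sum_(k < n)
    partial_derivative j (fun v : 'rV[K]_n => kz_z_of_u v 0 k) u
      *: kz_A k (kz_z_of_u u).

(* [W : 'M_(n, p)] covers both vector solutions (p = 1) and matrix ones. *)
Definition kz_system_z (K : numFieldType) (n p : nat) (rho : K)
    (W : 'rV[K]_n -> 'M[K]_(n, p)) : Prop :=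
  forall z, kz_config z -> forall j : 'I_n,
    partial_derivative j W z = rho *: (kz_A j z *m W z).

Definition kz_system_u (K : numFieldType) (n p : nat) (rho : K)
    (W : 'rV[K]_n -> 'M[K]_(n, p)) : Prop :=
  forall u, kz_udom u -> forall j : 'I_n,
    partial_derivative j W u = rho *: (kz_H j u *m W u).

(* Main.v *)
Require Import Defs.
From HB Require Import structures.
From mathcomp Require Import all_boot all_order all_algebra all_fingroup.
From mathcomp Require Import all_classical all_reals all_analysis.
From mathcomp Require Import ring.

Set Implicit Arguments.
Unset Strict Implicit.
Unset Printing Implicit Defensive.

Import Order.TTheory GRing.Theory Num.Theory.
Import numFieldNormedType.Exports.

Local Open Scope classical_set_scope.
Local Open Scope ring_scope.

(* The inverse change of variables is polynomial: z_k - z_(k+1) = u_1 ... u_k,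
   and the mean of the z_k is u_n / n.  Multiplying u_1 by a therefore replaces
   each z_k by a z_k + (1 - a) u_n / n.  Under this map A_k is multiplied by
   a^-1, and for j > 1 the derivative of z_k with respect to u_j is multiplied by
   a, up to an additive constant independent of k that appears only for j = n.
   The factors a and a^-1 cancel in H_j, and the constant contributes nothing,
   since the sum of all A_k is zero. *)

(** * Derivatives of row-vector-valued maps, coordinate by coordinate *)

Lemma differentiable_row (K : numFieldType) (n : nat) (V : normedModType K)
    (f : V -> 'rV[K]_n) (x : V) :
  (forall i, differentiable (fun y => f y 0 i) x) -> differentiable f x.
Proof.
move=> df.
rewrite (_ : f = \sum_(i < n) (fun y => f y 0 i *: delta_mx 0 i)).
  apply: differentiable_sum => i; apply: differentiableZl; exact: df.
by apply/funext => y; rewrite fct_sumE -row_sum_delta.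
Qed.

Lemma derive_coord (K : numFieldType) (n : nat) (V : normedModType K)
    (f : V -> 'rV[K]_n) (x v : V) (i : 'I_n) :
  derivable f x v -> 'D_v (fun y => f y 0 i) x = ('D_v f x) 0 i.
Proof.
move=> df; apply: cvg_lim => //.
rewrite (_ : (fun h : K => _) =
    (fun M : 'rV_n => M 0 i) \o
    (fun h : K => h^-1 *: ((f \o shift x) (h *: v) - f x))); last first.
  by apply/funext => h; rewrite /= !mxE.
exact: continuous_cvg (@coord_continuous _ _ _ _ _ _) df.
Qed.

Lemma derive_proj (K : numFieldType) (n : nat) (x v : 'rV[K]_n) (i : 'I_n) :
  'D_v (fun y : 'rV[K]_n => y 0 i) x = v 0 i.
Proof.
by rewrite (@derive_coord _ _ _ id) ?derive_id //; exact: derivable_id.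
Qed.

Lemma derive_comp_row (K : numFieldType) (n : nat) (V W : normedModType K)
    (f : V -> 'rV[K]_n) (g : 'rV[K]_n -> W) (x v : V) :
  differentiable f x -> differentiable g (f x) ->
  'D_v (g \o f) x =
  \sum_(k < n) 'D_v (fun y => f y 0 k) x *: partial_derivative k g (f x).
Proof.
move=> df dg; rewrite deriveE; last exact: differentiable_comp.
rewrite diff_comp //= -(deriveE _ df) (row_sum_delta ('D_v f x)) linear_sum.
apply: eq_bigr => k _; rewrite linearZ /= derive_coord; last first.
  exact: diff_derivable.
by rewrite /partial_derivative (deriveE _ dg).
Qed.

(** * The configuration set and the matrices A_k *)

Lemma nbhs_kz_config (K : numFieldType) (n : nat) (z : 'rV[K]_n) :
  kz_config z -> nbhs z (@kz_config K n).
Proof.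
move=> zc; pose P (k l : 'I_n) (w : 'rV[K]_n) := k != l -> w 0 k != w 0 l.
suff: \forall w \near z, forall k l, P k l w by [].
apply: (filter_forall (nbhs_filter z)) => k.
apply: (filter_forall (nbhs_filter z)) => l.
case: (eqVneq k l) => [->|kl]; first by near=> w => /eqP.
have : \forall w \near z, (w : 'rV[K]_n) 0 k - w 0 l != 0.
  apply: (cvgr_neq0 (F := nbhs z) (z 0 k - z 0 l)); last first.
    by rewrite subr_eq0; exact: zc.
  by apply: cvgB; exact: coord_continuous.
by apply: filterS => w + _; rewrite subr_eq0.
Unshelve. all: by end_near. Qed.

(** Exchanging the two indices of the double sum fixes the transposition matrix and negates the
    denominator, so the sum equals its opposite; the characteristic is zero. *)
Lemma sum_kz_A (K : numFieldType) (n : nat) (z : 'rV[K]_n) :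
  \sum_(k < n) kz_A k z = 0.
Proof.
set S := LHS; suff : S = - S.
  move/eqP; rewrite -addr_eq0 -mulr2n -scaler_nat scaler_eq0 pnatr_eq0.
  by move=> /eqP.
rewrite /S /kz_A [LHS](exchange_big_dep predT) //= -sumrN.
apply: eq_bigr => k _; rewrite -sumrN; apply: eq_big => [l|l _].
  by rewrite eq_sym.
by rewrite -scaleNr -invrN opprB /tperm_mx tpermC.
Qed.

(** The translation [c] cancels in each difference. The case [a = 0] is included, since the inverse
    of 0 is 0. *)
Lemma kz_A_affine (K : numFieldType) (n : nat) (k : 'I_n) (a c : K)
    (z w : 'rV[K]_n) : (forall i, w 0 i = a * z 0 i + c) ->
  kz_A k w = a^-1 *: kz_A k z.
Proof.
move=> wE; rewrite /kz_A scaler_sumr; apply: eq_bigr => l _.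
by rewrite scalerA -invfM !wE; congr (_^-1 *: _); ring.
Qed.

(** * The polynomial inverse of the change of variables *)

(* kz_gap u i is the difference z_i - z_(i+1) expressed in the variables u. *)
Definition kz_gap (K : numFieldType) (n : nat) (u : 'rV[K]_n.+1)
    (i : nat) : K :=
  \prod_(0 <= l < i.+1) u 0 (inord l).

Lemma kz_gap0 (K : numFieldType) (n : nat) (u : 'rV[K]_n.+1) :
  kz_gap u 0 = u 0 0.
Proof.
by rewrite /kz_gap big_nat1; congr (u 0 _); apply: val_inj; rewrite /= inordK.
Qed.

Lemma kz_gapS (K : numFieldType) (n : nat) (u : 'rV[K]_n.+1) (i : nat) :
  kz_gap u i.+1 = kz_gap u i * u 0 (inord i.+1).
Proof. by rewrite /kz_gap big_nat_recr. Qed.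

(** The quotient is z_1: summing z_k = z_1 - (gaps before k) over all k and solving for z_1 gives
    it. *)
Definition kz_inv (K : numFieldType) (n : nat) (u : 'rV[K]_n.+1) :
    'rV[K]_n.+1 :=
  \row_k ((u 0 ord_max + \sum_(m < n.+1) \sum_(i < m) kz_gap u i) / n.+1%:R
          - \sum_(i < k) kz_gap u i).

Lemma sum_kz_inv (K : numFieldType) (n : nat) (u : 'rV[K]_n.+1) :
  \sum_k kz_inv u 0 k = u 0 ord_max.
Proof.
under eq_bigr do rewrite mxE.
rewrite big_split /= sumrN sumr_const card_ord -[X in X - _]mulr_natr.
by rewrite divfK ?pnatr_eq0 // addrK.
Qed.

Lemma kz_inv_gap (K : numFieldType) (n : nat) (u : 'rV[K]_n.+1) (i : nat) :
  (i < n)%N -> kz_inv u 0 (inord i) - kz_inv u 0 (inord i.+1) = kz_gap u i.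
Proof.
move=> lin; rewrite !mxE !inordK ?ltnS ?(ltnW lin) //.
by rewrite [\sum_(j < i.+1) _]big_ord_recr /=; ring.
Qed.

Lemma kz_u_of_z_max (K : numFieldType) (n : nat) (z : 'rV[K]_n.+1) :
  kz_u_of_z z 0 ord_max = \sum_k z 0 k.
Proof. by rewrite mxE eqxx. Qed.

Lemma kz_u_of_z0 (K : numFieldType) (n : nat) (z : 'rV[K]_n.+2) :
  kz_u_of_z z 0 0 = z 0 (inord 0) - z 0 (inord 1).
Proof.
by rewrite mxE /=; congr (z 0 _ - z 0 _); apply: val_inj; rewrite /= inordK.
Qed.

Lemma kz_u_of_zS (K : numFieldType) (n : nat) (z : 'rV[K]_n.+2) (i : nat) :
  (i.+1 < n.+1)%N ->
  kz_u_of_z z 0 (inord i.+1) = (z 0 (inord i.+1) - z 0 (inord i.+2)) /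
                               (z 0 (inord i) - z 0 (inord i.+1)).
Proof.
move=> lin; have lin1 : (i.+1 < n.+2)%N by exact: ltnW.
have sE : ordS (inord i.+1 : 'I_n.+2) = inord i.+2.
  by apply: val_inj; rewrite /= !inordK // modn_small.
have pE : ord_pred (inord i.+1 : 'I_n.+2) = inord i.
  apply: val_inj; rewrite /= !inordK //; last exact: ltnW.
  by rewrite addSn /= modnDr modn_small // ltnW.
by rewrite mxE sE pE inordK // eqSS ltn_eqF.
Qed.

Lemma kz_u_of_zK (K : numFieldType) (n : nat) (z : 'rV[K]_n.+2) :
  kz_config z -> kz_inv (kz_u_of_z z) = z.
Proof.
move=> zc; pose y i := z 0 (inord i).
have gapE j : (j < n.+1)%N -> kz_gap (kz_u_of_z z) j = y j - y j.+1.
  elim: j => [_|i IH lin]; first by rewrite kz_gap0 kz_u_of_z0.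
  rewrite kz_gapS IH ?kz_u_of_zS ?(ltnW lin) // mulrC divfK // subr_eq0.
  apply: zc; rewrite -val_eqE /= !inordK ?(ltnW lin) //.
  - by rewrite ltn_eqF.
  - exact: ltnW.
  - exact/ltnW/ltnW.
have sumE (k : 'I_n.+2) : \sum_(i < k) kz_gap (kz_u_of_z z) i = y 0%N - z 0 k.
  transitivity (- \sum_(0 <= j < k) (y j.+1 - y j)).
    rewrite big_mkord -sumrN; apply: eq_bigr => j _; rewrite opprB; apply: gapE.
    by rewrite (leq_trans (ltn_ord j)) // -ltnS.
  by rewrite telescope_sumr // opprB /y inord_val.
apply/rowP => k; rewrite mxE sumE kz_u_of_z_max.
under [X in (_ + X) / _]eq_bigr do rewrite sumE.
(* The terms z_k cancel in pairs, so the numerator is z_1 times the number of variables. *)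
rewrite -big_split /=.
under eq_bigr do rewrite addrC subrK.
rewrite sumr_const card_ord -[y _ *+ _]mulr_natr mulfK ?pnatr_eq0 //.
by rewrite subKr.
Qed.

(** Recovering u_(k+1) as a ratio of consecutive gaps requires nonzero gaps, which the distinctness
    of the coordinates provides. *)
Lemma kz_invK (K : numFieldType) (n : nat) (u : 'rV[K]_n.+2) :
  kz_config (kz_inv u) -> kz_u_of_z (kz_inv u) = u.
Proof.
move=> zc; apply/rowP => i.
have [->|ni] := eqVneq i ord_max.
  by rewrite kz_u_of_z_max sum_kz_inv.
have gap_neq0 j : (j < n.+1)%N -> kz_gap u j != 0.
  move=> lj; rewrite -kz_inv_gap // subr_eq0; apply: zc.
  by rewrite -val_eqE /= !inordK ?ltn_eqF // ltnW.
have lin : (i < n.+1)%N.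
  by rewrite ltn_neqAle -ltnS ltn_ord andbT.
rewrite -[i]inord_val; case: (nat_of_ord i) lin => [|k] lk.
  rewrite (_ : inord 0 = 0); last by apply: val_inj; rewrite /= inordK.
  by rewrite kz_u_of_z0 kz_inv_gap // kz_gap0.
rewrite kz_u_of_zS // !kz_inv_gap ?(ltnW lk) // kz_gapS mulrC mulKf //.
exact/gap_neq0/ltnW.
Qed.

Lemma kz_z_of_uK (K : numFieldType) (n : nat) (z : 'rV[K]_n.+2) :
  kz_config z -> kz_z_of_u (kz_u_of_z z) = z.
Proof.
move=> zc; apply: pinvKV; last by rewrite inE.
move=> z1 z2; rewrite !inE => c1 c2 /(congr1 (@kz_inv K _)).
by rewrite !kz_u_of_zK.
Qed.

(** * Differentiability of both changes of variables *)

Lemma differentiable_kz_gap (K : numFieldType) (n : nat) (u : 'rV[K]_n.+1) i :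
  differentiable (fun v : 'rV[K]_n.+1 => kz_gap v i) u.
Proof.
elim: i => [|i IH].
  under eq_fun do rewrite kz_gap0.
  exact: differentiable_coord.
under eq_fun do rewrite kz_gapS.
apply: differentiableM => //; exact: differentiable_coord.
Qed.

Lemma differentiable_kz_inv (K : numFieldType) (n : nat) (u : 'rV[K]_n.+1) :
  differentiable (@kz_inv K n) u.
Proof.
have ds (m : nat) :
    differentiable (fun v : 'rV[K]_n.+1 => \sum_(i < m) kz_gap v i) u.
  rewrite (_ : (fun v => _) = \sum_(i < m) (fun v => kz_gap v i)).
    by apply: differentiable_sum => i; exact: differentiable_kz_gap.
  by apply/funext => v; rewrite fct_sumE.
apply: differentiable_row => k; under eq_fun do rewrite mxE.
apply: differentiableB => //; apply: differentiableM => //.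
apply: differentiableD; first exact: differentiable_coord.
rewrite (_ : (fun v => _) =
  \sum_(m < n.+1) (fun v : 'rV[K]_n.+1 => \sum_(i < m) kz_gap v i)).
  exact: differentiable_sum.
by apply/funext => v; rewrite fct_sumE.
Qed.

Lemma differentiable_kz_u_of_z (K : numFieldType) (n : nat) (z : 'rV[K]_n) :
  kz_config z -> differentiable (@kz_u_of_z K n) z.
Proof.
move=> zc; apply: differentiable_row => i; under eq_fun do rewrite mxE.
have dc j : differentiable (fun y : 'rV[K]_n => y 0 j : K) z.
  exact: differentiable_coord.
case: eqP => [_|/eqP ni].
  rewrite (_ : (fun v => _) = \sum_(m < n) (fun v : 'rV[K]_n => v 0 m)).
    exact: differentiable_sum.
  by apply/funext => v; rewrite fct_sumE.
case: eqP => [_|/eqP i0]; first exact: differentiableB.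
apply: differentiableM; first exact: differentiableB.
apply: differentiableV; first exact: differentiableB.
rewrite subr_eq0; apply: zc; rewrite -val_eqE /=.
(* For i > 0 the cyclic predecessor is i - 1, which differs from i, so the denominator does not
   vanish. *)
have i1 : i = i.-1.+1 :> nat by rewrite prednK // lt0n.
rewrite [X in (X + n)%N]i1 addSn /= modnDr modn_small.
  by rewrite [X in _ != X]i1 ltn_eqF.
by rewrite (leq_ltn_trans (leq_pred _)).
Qed.

(** Since [kz_z_of_u] has junk values off [kz_udom], differentiating it requires agreement on a
    whole neighbourhood. The preimage of the open configuration set under the continuous map
    [kz_inv] is one, and each of its points v is the image of [kz_inv v] by [kz_invK]. *)
Lemma near_kz_z_of_u (K : numFieldType) (n : nat) (u : 'rV[K]_n.+2) :
  kz_udom u -> {near u, @kz_z_of_u K n.+2 =1 @kz_inv K n.+1}.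
Proof.
case=> z zc <-.
have cont : {for kz_u_of_z z, continuous (@kz_inv K n.+1)}.
  exact/differentiable_continuous/differentiable_kz_inv.
have /cont : nbhs (kz_inv (kz_u_of_z z)) (@kz_config K n.+2).
  by rewrite kz_u_of_zK //; exact: nbhs_kz_config.
apply: (@filterS _ (nbhs (kz_u_of_z z)) _) => v vc.
by rewrite -{1}(kz_invK vc) kz_z_of_uK.
Qed.

(** * The chain rule and the equivalence of the two systems *)

Lemma derive_kz_z_of_u (K : numFieldType) (n : nat) (V : normedModType K)
    (W : 'rV[K]_n.+2 -> V) (j : 'I_n.+2) (u : 'rV[K]_n.+2) :
  kz_udom u -> partial_derivative j (W \o @kz_z_of_u K n.+2) u =
               partial_derivative j (W \o @kz_inv K n.+1) u.
Proof.
move=> ud; apply: near_eq_derive.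
by apply: (@filterS _ (nbhs u) _ _ _ _ (near_kz_z_of_u ud)) => v /= ->.
Qed.

Lemma kz_chain_u (K : numFieldType) (n : nat) (V : normedModType K)
    (W : 'rV[K]_n.+2 -> V) (j : 'I_n.+2) (z : 'rV[K]_n.+2) :
  kz_config z -> differentiable W z ->
  partial_derivative j (W \o @kz_z_of_u K n.+2) (kz_u_of_z z) =
  \sum_(k < n.+2)
    partial_derivative j (fun v => kz_z_of_u v 0 k) (kz_u_of_z z)
      *: partial_derivative k W z.
Proof.
move=> zc dW; have ud : kz_udom (kz_u_of_z z) by exists z.
rewrite derive_kz_z_of_u // [LHS]derive_comp_row ?kz_u_of_zK //; last first.
  exact: differentiable_kz_inv.
apply: eq_bigr => k _; congr (_ *: _).
by rewrite (derive_kz_z_of_u (fun w => w 0 k) j ud).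
Qed.

Lemma kz_chain_z (K : numFieldType) (n : nat) (V : normedModType K)
    (W : 'rV[K]_n.+2 -> V) (k : 'I_n.+2) (z : 'rV[K]_n.+2) :
  kz_config z -> differentiable W z ->
  partial_derivative k W z =
  \sum_(j < n.+2)
    partial_derivative k (fun w => kz_u_of_z w 0 j) z
      *: partial_derivative j (W \o @kz_z_of_u K n.+2) (kz_u_of_z z).
Proof.
move=> zc dW; have ud : kz_udom (kz_u_of_z z) by exists z.
under eq_bigr do rewrite derive_kz_z_of_u //.
rewrite -derive_comp_row; last first.
- apply: differentiable_comp; first exact: differentiable_kz_inv.
  by rewrite kz_u_of_zK.
- exact: differentiable_kz_u_of_z.
apply: near_eq_derive.
apply: (@filterS _ (nbhs z) _ _ _ _ (nbhs_kz_config zc)) => w wc.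
by rewrite /= kz_u_of_zK.
Qed.

(** This is [kz_chain_z] applied to the coordinate function z_i. *)
Lemma kz_jacobian_mulV (K : numFieldType) (n : nat) (i k : 'I_n.+2)
    (z : 'rV[K]_n.+2) :
  kz_config z ->
  \sum_(j < n.+2) partial_derivative k (fun w => kz_u_of_z w 0 j) z *
    partial_derivative j (fun v => kz_z_of_u v 0 i) (kz_u_of_z z) =
  (i == k)%:R.
Proof.
move=> zc; have := kz_chain_z k zc (@differentiable_coord K 1 n.+2 z 0 i).
by rewrite {1}/partial_derivative derive_proj mxE eqxx /= => <-.
Qed.

(* From the u-system back to the z-system, the chain rule is applied to W written
   as (W o z(u)) o u(z), and the two Jacobian matrices cancel. *)
Lemma kz_system_zu (K : numFieldType) (n p : nat) (rho : K)
    (W : 'rV[K]_n.+2 -> 'M[K]_(n.+2, p)) :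
  (forall z, kz_config z -> differentiable W z) ->
  kz_system_z rho W <-> kz_system_u rho (W \o @kz_z_of_u K n.+2).
Proof.
move=> dW; split=> sys.
  move=> _ [z zc <-] j; rewrite kz_chain_u //; last exact: dW.
  rewrite /= /kz_H kz_z_of_uK // mulmx_suml scaler_sumr; apply: eq_bigr => k _.
  by rewrite sys // -scalemxAl !scalerA mulrC.
move=> z zc k; have ud : kz_udom (kz_u_of_z z) by exists z.
rewrite kz_chain_z //; last exact: dW.
under eq_bigr => j _.
  rewrite sys //= /kz_H kz_z_of_uK // mulmx_suml !scaler_sumr.
  under eq_bigr => i _ do
    rewrite -scalemxAl [rho *: _]scalerA [rho * _]mulrC scalerA mulrA -scalerA.
  over.
(* With the sum over j innermost, the coefficients are entries of the product of the Jacobian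
   matrices; only i = k survives. *)
rewrite exchange_big /= (bigD1 k) //= [X in _ + X]big1 => [|i /negPf ik].
  by rewrite -scaler_suml kz_jacobian_mulV // eqxx scale1r addr0.
by rewrite -scaler_suml kz_jacobian_mulV // ik scale0r.
Qed.

(** * Scaling u_1 *)

Lemma kz_gap_scale (K : numFieldType) (n : nat) (a : K) (u v : 'rV[K]_n.+1)
    (i : nat) :
  v 0 0 = a * u 0 0 -> (forall k : 'I_n.+1, (0 < k)%N -> v 0 k = u 0 k) ->
  (i < n.+1)%N -> kz_gap v i = a * kz_gap u i.
Proof.
move=> v0 vS; elim: i => [_|i IH lin]; first by rewrite !kz_gap0.
by rewrite !kz_gapS IH ?vS ?inordK ?mulrA // ltnW.
Qed.

(** Every gap contains u_1 exactly once and scales by [a], whereas u_n stays fixed; the last term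
    compensates for this in the mean. *)
Lemma kz_inv_scale (K : numFieldType) (n : nat) (a : K) (u v : 'rV[K]_n.+2)
    (k : 'I_n.+2) :
  v 0 0 = a * u 0 0 -> (forall k : 'I_n.+2, (0 < k)%N -> v 0 k = u 0 k) ->
  kz_inv v 0 k = a * kz_inv u 0 k + (1 - a) / n.+2%:R * u 0 ord_max.
Proof.
move=> v0 vS.
have sumE (m : 'I_n.+2) : \sum_(i < m) kz_gap v i = a * \sum_(i < m) kz_gap u i.
  rewrite mulr_sumr; apply: eq_bigr => i _.
  by rewrite (kz_gap_scale v0 vS) // (ltn_trans (ltn_ord i)).
rewrite !mxE sumE vS //.
under [X in (_ + X) / _]eq_bigr do rewrite sumE.
by rewrite -mulr_sumr; ring.
Qed.

Lemma derive_kz_inv_scale (K : numFieldType) (n : nat) (a : K)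
    (u v : 'rV[K]_n.+2) (j k : 'I_n.+2) :
  v 0 0 = a * u 0 0 -> (forall k : 'I_n.+2, (0 < k)%N -> v 0 k = u 0 k) ->
  (0 < j)%N ->
  partial_derivative j (fun w => kz_inv w 0 k) v =
  a * partial_derivative j (fun w => kz_inv w 0 k) u
  + (1 - a) / n.+2%:R * (j == ord_max)%:R.
Proof.
move=> v0 vS j0; set e : 'rV[K]_n.+2 := delta_mx 0 j.
pose F (w : 'rV[K]_n.+2) :=
  a *: kz_inv w 0 k + ((1 - a) / n.+2%:R) *: w 0 ord_max.
have dZ : derivable (fun w : 'rV[K]_n.+2 => kz_inv w 0 k) u e.
  apply: diff_derivable.
  apply: (@differentiable_comp _ _ _ _ (@kz_inv K n.+1) (fun M => M 0 k)).
    exact: differentiable_kz_inv.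
  exact: differentiable_coord.
have dc : derivable (fun w : 'rV[K]_n.+2 => w 0 ord_max) u e.
  exact/diff_derivable/differentiable_coord.
transitivity ('D_e F u).
  rewrite /partial_derivative -/e /derive.
  rewrite [X in X @ _](_ : _ =
    fun h => h^-1 *: ((F \o shift u) (h *: e) - F u)) //.
  apply/funext => h /=; rewrite /F /= -(kz_inv_scale _ v0 vS).
  (* A move in direction j > 0 leaves u_1 alone, so the two displaced points are still related by
     the same scaling and the difference quotients coincide. *)
  rewrite -(@kz_inv_scale _ _ _ _ (h *: e + v)) // => [|i i0].
    by rewrite !mxE [0 == j]ltn_eqF // mulr0 !add0r.
  by rewrite !mxE vS.
rewrite deriveD ?deriveZ //; do ?exact: derivableZ.
by rewrite derive_proj !mxE eqxx eq_sym.
Qed.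

Lemma kz_H_indep (K : numFieldType) (n : nat) (j : 'I_n.+2)
    (u v : 'rV[K]_n.+2) :
  (0 < j)%N -> kz_udom u -> kz_udom v ->
  (forall k : 'I_n.+2, (0 < k)%N -> u 0 k = v 0 k) ->
  kz_H j u = kz_H j v.
Proof.
move=> j0 ud vd uv.
have n0 (w : 'rV[K]_n.+2) : kz_udom w -> w 0 0 != 0.
  case=> z zc <-; rewrite kz_u_of_z0 subr_eq0; apply: zc.
  by rewrite -val_eqE /= !inordK.
(* On [kz_udom] the coordinate u_1 = z_1 - z_2 is nonzero, so this ratio is defined and
   invertible. *)
pose a := v 0 0 / u 0 0.
have a0 : a != 0 by rewrite mulf_neq0 ?invr_eq0 ?n0.
have v0 : v 0 0 = a * u 0 0 by rewrite divfK ?n0.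
have vS (k : 'I_n.+2) : (0 < k)%N -> v 0 k = u 0 k by move=> /uv.
have HE (w : 'rV[K]_n.+2) : kz_udom w -> kz_H j w = \sum_k
    partial_derivative j (fun x => kz_inv x 0 k) w *: kz_A k (kz_inv w).
  move=> wd; apply: eq_bigr => k _; congr (_ *: kz_A k _).
    exact: (derive_kz_z_of_u (fun x => x 0 k) j wd).
  exact: nbhs_singleton (near_kz_z_of_u wd).
rewrite !HE //.
under [RHS]eq_bigr => k _.
  rewrite (derive_kz_inv_scale _ v0 vS j0).
  rewrite (kz_A_affine _ (fun i => kz_inv_scale i v0 vS)).
  rewrite scalerDl scalerA mulrAC divff // mul1r.
  over.
(* The additive part of the derivative does not depend on k, so it factors out of the sum of all
   A_k, which is zero. *)
by rewrite big_split /= -!scaler_sumr sum_kz_A !scaler0 addr0.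
Qed.

(* The first conjunct says that the H_j are the coefficients of the system
   written in the variables u; the second is the independence of u_1. *)
Theorem proposition4p1 (K : numFieldType) (n : nat) (hn : (1 < n)%N) :
  (forall (rho : K) (p : nat) (W : 'rV[K]_n -> 'M[K]_(n, p)),
     (forall z, kz_config z -> differentiable W z) ->
     kz_system_z rho W <-> kz_system_u rho (W \o @kz_z_of_u K n))
  /\
  (forall j : 'I_n, (0 < j)%N ->
     forall u v : 'rV[K]_n, kz_udom u -> kz_udom v ->
       (forall k : 'I_n, (0 < k)%N -> u 0 k = v 0 k) ->
       kz_H j u = kz_H j v).
Proof.
case: n hn => [|[|n]] // _; split=> [rho p W|j j0 u v].
  exact: kz_system_zu.
exact: kz_H_indep.
Qed.
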